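(* Let $\mathscr D\subset W$ be a center persistence diagram (all features of one fixed degree of homology) and let $\sigma>0$ be a bandwidth. Split $\mathscr D$ into $\mathscr D^u$ and $\mathscr D^\ell$, and let $N_u=|\mathscr D^u|$. Let $D^u$ and $D^\ell$ be the upper and lower random persistence diagrams centered at $\mathscr D^u$ and $\mathscr D^\ell$ (as defined in the context), and suppose $D^u$ and $D^\ell$ are independent. Then the kernel density centered at $\mathscr D$ with bandwidth $\sigma$, that is, the global pdf of $D=D^u\cup D^\ell$, is given, for every $N\ge 0$ and $Z=(\xi_1,\dots,\xi_N)\in W^N$, by $$K_\sigma(Z,\mathscr D)=\sum_{j=0}^{N_u}\nu(N-j)\sum_{\gamma\in I(j,N_u)}\mathcal Q(\gamma)\prod_{k=1}^{j}p^{(\gamma(k))}(\xi_k)\prod_{k=j+1}^{N}p^\ell(\xi_k).$$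
   Context: **Random persistence diagrams.** $W=\{(b,d)\in\mathbb R^2: d>b\ge 0\}$ with Lebesgue measure. A persistence diagram (of a fixed degree of homology) is a finite multiset of features in $W$. The space $\mathcal C_{\le M}(W)$ of multisets of cardinality at most $M$ carries the topology in which, for each $N\le M$, the multisets of cardinality $N$ are homeomorphic to $W^N/\Pi_N$ ($\Pi_N$ = permutations of $\{1,\dots,N\}$) via $(\xi_1,\dots,\xi_N)\mapsto\{\xi_1,\dots,\xi_N\}$; a random persistence diagram is a random element of this space. Unions of diagrams are multiset unions (multiplicities add). Its belief function is $\beta_D(A)=\mathbb P[D\subset A]$, $A\subset W$ Borel. The set derivatives $\frac{\delta^N\beta_D}{\delta\xi_1\cdots\delta\xi_N}(\emptyset)$ are the symmetric functions on $W^N$ (unique up to null sets) such that $\beta_D(A)=\sum_{N\ge0}\frac1{N!}\int_{A^N}\frac{\delta^N\beta_D}{\delta\xi_1\cdots\delta\xi_N}(\emptyset)\,d\xi_1\cdots d\xi_N$ for all Borel $A$. A global pdf of $D$ is a function $f_D:\bigcup_N W^N\to\mathbb R$ with $\sum_{\pi\in\Pi_N}f_D(\xi_{\pi(1)},\dots,\xi_{\pi(N)})=\frac{\delta^N\beta_D}{\delta\xi_1\cdots\delta\xi_N}(\emptyset)$ for every $N$ (it need not be symmetric, and ''the'' global pdf means a function with this property). **Splitting.** $\mathscr D^u=\{(b_i,d_i)\in\mathscr D:d_i-b_i\ge\sigma\}$, $\mathscr D^\ell=\{(b_i,d_i)\in\mathscr D:d_i-b_i<\sigma\}$, $N_u=|\mathscr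 D^u|$, $N_\ell=|\mathscr D^\ell|$. **Upper diagram.** Enumerate the features of $\mathscr D^u$ as $(b_j,d_j)$, $j=1,\dots,N_u$. Let $\varphi_j$ be the density of the normal $N((b_j,d_j),\sigma^2 I_2)$ on $\mathbb R^2$, $q^{(j)}=\int_{\{v>u\}}\varphi_j(u,v)\,du\,dv$, and $p^{(j)}(b,d)=\frac{\varphi_j(b,d)}{\int_W\varphi_j(u,v)\,du\,dv}\mathbf 1_W(b,d)$. Let $D^1,\dots,D^{N_u}$ be independent random diagrams with $|D^j|\le1$, $\mathbb P[D^j\ne\emptyset]=q^{(j)}$, and, given $|D^j|=1$, the feature of $D^j$ has density $p^{(j)}$. Then $D^u=\bigcup_jD^j$. **Lower diagram.** $\nu$ is a probability mass function on $\{0,1,2,\dots\}$ (depending on $N_\ell$) with mean $N_\ell$ and $\nu(n)=0$ for $n>mN_\ell$, where $m>0$ is a constant independent of $N_\ell$; set $\nu(n)=0$ for $n<0$. The density $p^\ell$ is the probability density on $W$ proportional to $$\mathbf 1_W(b,d)\,\frac1{N_\ell}\sum_{(b_i,d_i)\in\mathscr D^\ell}\frac1{\pi\sigma^2}\exp\Big(-\tfrac{(b-\frac{b_i+d_i}2)^2+(d-\frac{b_i+d_i}2)^2}{2\sigma^2}\Big).$$ $D^\ell$ is obtained by drawing a cardinality $N$ from $\nu$ and then $N$ i.i.d. features from $p^\ell$; its global pdf is $f_{D^\ell}(\xi_1,\dots,\xi_N)=\nu(N)\prod_{j=1}^Np^\ell(\xi_j)$. If $N_\ell=0$, then $\nu(0)=1$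 and $D^\ell=\emptyset$. **Weights.** $I(j,N_u)$ is the set of increasing injections $\gamma:\{1,\dots,j\}\to\{1,\dots,N_u\}$. $\mathcal Q^*(\gamma)=\frac{\prod_{i=1}^{N_u}(1-q^{(i)})}{\prod_{k=1}^{j}(1-q^{(\gamma(k))})}$ and $\mathcal Q(\gamma)=\mathcal Q^*(\gamma)\prod_{k=1}^jq^{(\gamma(k))}$. *)

(* Defs.v *)
From HB Require Import structures.
From mathcomp Require Import all_boot all_order all_algebra.
From mathcomp Require Export perm finmap multiset.
From mathcomp Require Import all_classical all_reals all_analysis.
Export numFieldNormedType.Exports.

Set Implicit Arguments.
Unset Strict Implicit.
Unset Printing Implicit Defensive.

Import Order.TTheory GRing.Theory Num.Theory.
Local Open Scope classical_set_scope.
Local Open Scope ring_scope.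

(* R * R with the Borel sigma-algebra for which lebesgue_measure is defined. *)
Notation plane R := (measurableTypeR R * measurableTypeR R)%type.
Notation diagram R := {mset (R * R)%type}%mset.

Section diagrams.
Context {R : realType}.

Definition wedge : set (R * R) := [set x | 0 <= x.1 /\ x.1 < x.2].

Definition leb2 : set (plane R) -> \bar R :=
  (@lebesgue_measure R \x @lebesgue_measure R)%E.

(* Lebesgue measure on (R * R)^n; its restriction to wedge^n is the reference
   measure dxi_1 ... dxi_n. *)
Fixpoint lebn (n : nat) : set (n.-tuple (plane R)) -> \bar R :=
  match n with
  | 0 => \d_([tuple] : 0.-tuple (plane R))
  | n'.+1 => pushforward (leb2 \x @lebn n')%E
               (fun xt => [tuple of xt.1 :: xt.2])
  end.

Definition power (A : set (R * R)) (n : nat) : set (n.-tuple (R * R)) :=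
  [set t | forall i, A (tnth t i)].
Arguments power : clear implicits.

Definition permt (n : nat) (s : 'S_n) (t : n.-tuple (R * R)) :
  n.-tuple (R * R) := [tuple tnth t (s i) | i < n].

(* The space C_{<=M}(W).  The cardinality of a multiset S is [size S], through
   the coercion of a multiset to the list of its elements with repetitions. *)
Definition diagrams_le (M : nat) : set (diagram R) :=
  [set S | (size S <= M)%N /\ [set` S] `<=` wedge].

(* Disjoint union, over N <= M, of the quotient topologies of W^N / Pi_N: U is
   open iff its preimage in each W^N is relatively open. *)
Definition open_diagrams (M : nat) : set (set (diagram R)) :=
  [set U | U `<=` diagrams_le M /\
     forall N, (N <= M)%N ->
       exists2 O : set (prod_topology (fun _ : 'I_N => (R * R)%type)), open O &
         forall t : N.-tuple (R * R), power wedge N t ->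
           (U (seq_mset t) <-> O (tnth t))].

Definition borel_diagrams (M : nat) : set (set (diagram R)) :=
  <<s diagrams_le M, open_diagrams M >>.

Definition lower_part (sigma : R) (D : diagram R) : diagram R :=
  seq_mset [seq x <- enum_mset D | x.2 - x.1 < sigma].
Definition upper_part (sigma : R) (D : diagram R) : diagram R :=
  seq_mset [seq x <- enum_mset D | sigma <= x.2 - x.1].

(* Density of N(c, sigma^2 I_2): the two coordinates are independent. *)
Definition gauss2 (sigma : R) (c x : R * R) : R :=
  normal_pdf c.1 sigma x.1 * normal_pdf c.2 sigma x.2.

Definition upper_weight (sigma : R) (c : R * R) : R :=
  fine (\int[leb2]_(x in [set x : R * R | (x.1 < x.2)%R]) (gauss2 sigma c x)%:E)%E.

Definition upper_density (sigma : R) (c x : R * R) : R :=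
  gauss2 sigma c x / fine (\int[leb2]_(y in wedge) (gauss2 sigma c y)%:E)%E
    * \1_wedge x.

Definition lower_shape (sigma : R) (L : diagram R) (x : R * R) : R :=
  \1_wedge x * ((size L)%:R^-1 *
    \sum_(c <- enum_mset L) (pi * sigma ^+ 2)^-1 *
      expR (- ((x.1 - (c.1 + c.2) / 2) ^+ 2 + (x.2 - (c.1 + c.2) / 2) ^+ 2)
              / (2 * sigma ^+ 2))).

(* When L is empty this is 0 / 0 = 0, and no feature is ever drawn from it. *)
Definition lower_density (sigma : R) (L : diagram R) (x : R * R) : R :=
  lower_shape sigma L x /
    fine (\int[leb2]_(y in wedge) (lower_shape sigma L y)%:E)%E.

Definition cardinality_law (m : R) (Nl : nat) (nu : nat -> R) : Prop :=
  [/\ forall n, 0 <= nu n,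
      (\sum_(0 <= n <oo) (nu n)%:E = 1)%E,
      (\sum_(0 <= n <oo) (n%:R * nu n)%:E = (Nl%:R)%:E)%E &
      forall n, m * Nl%:R < n%:R -> nu n = 0].

Definition extend0 (nu : nat -> R) (k : int) : R :=
  if k is Posz n then nu n else 0.

Definition increasing (j n : nat) (g : {ffun 'I_j -> 'I_n}) : bool :=
  [forall a : 'I_j, forall b : 'I_j, (a < b)%N ==> (g a < g b)%N].

Definition Qstar (n : nat) (q : 'I_n -> R) (j : nat) (g : {ffun 'I_j -> 'I_n}) : R :=
  (\prod_(i < n) (1 - q i)) / \prod_(k < j) (1 - q (g k)).

Definition Qweight (n : nat) (q : 'I_n -> R) (j : nat) (g : {ffun 'I_j -> 'I_n}) : R :=
  Qstar q g * \prod_(k < j) q (g k).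

Section random.
Context {d : measure_display} {Omega : measurableType d}.
Variable P : probability Omega R.

Definition random_diagram (M : nat) (X : Omega -> diagram R) : Prop :=
  (forall w, diagrams_le M (X w)) /\
  (forall B, borel_diagrams M B -> measurable (X @^-1` B)).

Definition belief (X : Omega -> diagram R) (A : set (R * R)) : \bar R :=
  P [set w | [set` X w] `<=` A].

(* Integrability is what gives the integrals over A^n their meaning. *)
Definition set_derivatives (X : Omega -> diagram R)
    (g : forall n, n.-tuple (R * R) -> R) : Prop :=
  [/\ forall n, (@lebn n).-integrable (power wedge n) (EFin \o @g n),
      forall n (s : 'S_n) t, power wedge n t -> g n (permt s t) = g n t &
      forall A : set (plane R), measurable A -> A `<=` wedge ->
        belief X A = (\sum_(0 <= n <oo)
          ((n`!%:R)^-1)%:E * \int[@lebn n]_(t in power A n) (g n t)%:E)%E].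

(* Set derivatives are only determined up to null sets: the symmetrization of f
   has to be one version of them. *)
Definition global_pdf (X : Omega -> diagram R)
    (f : forall n, n.-tuple (R * R) -> R) : Prop :=
  exists2 g, set_derivatives X g &
    forall n t, power wedge n t -> \sum_(s : 'S_n) f n (permt s t) = g n t.

Definition independent (M M' : nat) (X Y : Omega -> diagram R) : Prop :=
  forall B C, borel_diagrams M B -> borel_diagrams M' C ->
    P (X @^-1` B `&` Y @^-1` C) = (P (X @^-1` B) * P (Y @^-1` C))%E.

Definition mutually_independent (M n : nat)
    (X : 'I_n -> Omega -> diagram R) : Prop :=
  forall (J : {set 'I_n}) (B : 'I_n -> set (diagram R)),
    (forall j, j \in J -> borel_diagrams M (B j)) ->
    P (\bigcap_(j in [set` J]) X j @^-1` B j) =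
      (\prod_(j in J) P (X j @^-1` B j))%E.

(* The last clause is the conditional law of the feature given |X| = 1, with
   the conditioning probability multiplied out. *)
Definition singleton_diagram (q : R) (p : R * R -> R)
    (X : Omega -> diagram R) : Prop :=
  [/\ random_diagram 1 X,
      P [set w | X w != mset0] = q%:E &
      forall A : set (plane R), measurable A -> A `<=` wedge ->
        P [set w | exists2 x, A x & X w = [mset x]%mset] =
          (P [set w | size (X w) = 1%N] * \int[leb2]_(x in A) (p x)%:E)%E].

(* Law of X: draw n from nu, then n i.i.d. points from the density p. *)
Definition iid_diagram (M : nat) (nu : nat -> R) (p : R * R -> R)
    (X : Omega -> diagram R) : Prop :=
  random_diagram M X /\
  forall B, borel_diagrams M B ->
    P (X @^-1` B) = (\sum_(0 <= n <oo) (nu n)%:E *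
      \int[@lebn n]_(t in [set t | power wedge n t /\ B (seq_mset t)])
        (\prod_(k < n) p (tnth t k))%:E)%E.

End random.
End diagrams.

(* Main.v *)
Require Import Defs.
From HB Require Import structures.
From mathcomp Require Import all_boot all_order all_algebra.
From mathcomp Require Import all_classical all_reals all_analysis.
From mathcomp Require Import measurable_realfun lebesgue_integral_fubini.

(** Both sides of the expansion that defines the set derivatives can be computed.
    Let [A] be a Borel subset of the wedge, and write [a_j] and [b] for the
    integrals over [A] of the density of the [j]-th upper feature and of the lower
    density. By independence, the probability that the union lies in [A] is
    the product of [1 - q_j + q_j a_j] over the upper features, times the sum over
    [n] of [nu(n) b^n] ([belief_union], [belief_iid]).

    Expanding the product amounts to choosing which upper diagrams are nonempty.
    Such a set of indices is the image of exactly one increasing injection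
    [gamma], and it contributes [Q(gamma)] times the product of the [a_gamma(k)]
    ([prod_choice_increasing]). The Cauchy product with the lower series
    ([nneseries_convolution]) collects in degree [N] the sum over [j] of
    [nu(N - j)], times the contributions of the [gamma] with [j] values, times
    [b^(N - j)].

    By Tonelli's theorem this coefficient is the integral over the [N]-th power of
    [A] of the claimed density, and also of the density with its arguments
    permuted ([has_integral_union_density]). Summing over the permutations gives
    the symmetric function required of a set derivative and multiplies the
    integral by [N!], which cancels the [1 / N!] of the expansion.

    Three points need care. Independence is stated for events that are Borel for
    the quotient topology, so the event of lying in [A] has to be Borel
    ([borel_inside]): counting the points of a diagram in [A] reduces this to open
    sets by a lambda-system argument. The weights divide by [1 - q_j], so each
    [q_j] has to be less than 1 ([upper_weight_lt1]). Finally, the law of the lower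
    diagram does not record [nu] beyond the bound on its cardinality, but the
    density does; total mass forces [nu] to vanish there ([iid_cardinality_le]). *)

Set Implicit Arguments.
Unset Strict Implicit.
Unset Printing Implicit Defensive.

Import Order.TTheory GRing.Theory Num.Theory.
Local Open Scope classical_set_scope.
Local Open Scope ring_scope.

(** * Lebesgue measure on the space of n-tuples of points *)

Section lebesgue_power.
Context {R : realType}.
Local Open Scope ereal_scope.

Lemma sigma_finite_product_measure1 d1 d2 (T1 : measurableType d1)
    (T2 : measurableType d2) (m1 : {sigma_finite_measure set T1 -> \bar R})
    (m2 : {sigma_finite_measure set T2 -> \bar R}) :
  sigma_finite [set: T1 * T2] (m1 \x m2).
Proof.
have /sigma_finiteP[F [TF ndF Foo]] := sigma_finiteT m1.
have /sigma_finiteP[G [TG ndG Goo]] := sigma_finiteT m2.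
exists (fun n => F n `*` G n).
  apply/seteqP; split => // -[x y] _.
  have : [set: T1] x by []. have : [set: T2] y by [].
  rewrite TF TG => -[k _ Gy] [n _ Fx]; exists (maxn n k) => //; split => /=.
    by move: x Fx; exact/subsetPset/ndF/leq_maxl.
  by move: y Gy; exact/subsetPset/ndG/leq_maxr.
move=> n; have [mF Fn] := Foo n; have [mG Gn] := Goo n.
split; first exact: measurableX.
by rewrite product_measure1E// lte_mul_pinfty// ge0_fin_numE.
Qed.

Definition product_sigma_finite d1 d2 (T1 : measurableType d1)
    (T2 : measurableType d2) (m1 : {sigma_finite_measure set T1 -> \bar R})
    (m2 : {sigma_finite_measure set T2 -> \bar R}) :
    {sigma_finite_measure set (T1 * T2)%type -> \bar R} :=
  HB.pack (m1 \x m2) (Measure_isSigmaFinite.Build _ _ _ (m1 \x m2)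
    (sigma_finite_product_measure1 m1 m2)).

Definition leb2_measure : {sigma_finite_measure set (plane R) -> \bar R} :=
  product_sigma_finite (@lebesgue_measure R) (@lebesgue_measure R).

Definition cons_pair n (xt : plane R * n.-tuple (plane R)) :
  n.+1.-tuple (plane R) := [tuple of xt.1 :: xt.2].

Lemma measurable_cons_pair n : measurable_fun setT (@cons_pair n).
Proof. exact: (measurable_cons measurable_fst measurable_snd). Qed.

(** Prepending a point is undone by splitting the head off, so a sigma-finite
    exhaustion can be pulled back along that measurable inverse. *)
Lemma pushforward_cons_pair_sigma_finite n
    (mu : {sigma_finite_measure set (plane R * n.-tuple (plane R))%type -> \bar R}) :
  sigma_finite setT (pushforward mu (@cons_pair n)).
Proof.
have /sigma_finiteP[F [TF ndF Foo]] := sigma_finiteT mu.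
pose uncons (t : n.+1.-tuple (plane R)) := (thead t, [tuple of behead t]).
have consK : cancel (@cons_pair n) uncons.
  by move=> [x t]; rewrite /uncons/= theadE; congr pair; exact/val_inj.
have muncons : measurable_fun setT uncons.
  apply/measurable_fun_pair; [exact: measurable_tnth|exact: measurable_behead].
exists (fun k => uncons @^-1` F k).
  by rewrite -preimage_bigcup -TF preimage_setT.
move=> k; have [mF Fk] := Foo k; split.
  by rewrite -[X in measurable X]setTI; exact: muncons.
rewrite /pushforward -comp_preimage (_ : uncons \o _ = id) //.
by apply/funext => x /=; rewrite consK.
Qed.

(** [lebn] is a bare set function; integration theory needs the measure behind
    it, and Tonelli's theorem its sigma-finiteness. *)
Lemma lebn_sigma_finite n :
  exists mu : {sigma_finite_measure set (n.-tuple (plane R)) -> \bar R},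
    @lebn R n = mu.
Proof.
elim: n => [|n [mu IH]].
  by exists \d_([tuple] : 0.-tuple (plane R)).
pose nu := product_sigma_finite leb2_measure mu.
pose mix := Measure_isSigmaFinite.Build _ _ _ (pushforward nu (@cons_pair n))
  (pushforward_cons_pair_sigma_finite nu).
pose res : {sigma_finite_measure set (n.+1.-tuple (plane R)) -> \bar R} :=
  HB.pack (pushforward nu (@cons_pair n)) (mix (@measurable_cons_pair n)).
by exists (res (@measurable_cons_pair n)); rewrite /= IH.
Qed.

End lebesgue_power.

Section lebesgue_power_integral.
Context {R : realType}.
Local Open Scope ereal_scope.

Lemma measurable_prod_tnth n (h : 'I_n -> plane R -> R) :
  (forall k, measurable_fun setT (h k)) ->
  measurable_fun [set: n.-tuple (plane R)]
    (fun t => \prod_(k < n) h k (tnth t k))%R.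
Proof.
move=> mh; apply: measurable_prod => k _.
exact: measurableT_comp (mh k) (measurable_tnth k).
Qed.

(** Tonelli's theorem, splitting off one point at a time. *)
Lemma integral_lebn_prodT n (h : 'I_n -> plane R -> R) :
  (forall k, measurable_fun setT (h k)) -> (forall k x, 0 <= h k x)%R ->
  \int[@lebn R n]_t (\prod_(k < n) h k (tnth t k))%:E =
  \prod_(k < n) \int[leb2]_x (h k x)%:E.
Proof.
elim: n h => [|n IH] h mh h0.
  rewrite big_ord0 (eq_integral (cst 1)) => [|t _]; last by rewrite big_ord0.
  by rewrite integral_dirac// diracT mule1.
have [mu muE] := lebn_sigma_finite (R := R) n.
have mtail : measurable_fun setT (EFin \o (fun t : n.-tuple (plane R) =>
    \prod_(k < n) h (lift ord0 k) (tnth t k))%R).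
  apply/measurable_EFinP; apply: (@measurable_prod_tnth n (fun k => h (lift ord0 k))).
  by move=> k; exact: mh.
have h0E k x : 0 <= (h k x)%:E by rewrite lee_fin.
have mhE k : measurable_fun setT (EFin \o h k) by apply/measurable_EFinP.
have consE (xt : plane R * n.-tuple (plane R)) :
    (\prod_(k < n.+1) h k (tnth (cons_pair xt) k))%:E =
    (h ord0 xt.1)%:E * (\prod_(k < n) h (lift ord0 k) (tnth xt.2 k))%:E.
  rewrite big_ord_recl EFinM; congr (_%:E * _%:E).
  by apply: eq_bigr => k _; rewrite tnthS.
rewrite -[LHS]/(\int[pushforward (leb2 \x @lebn R n) (@cons_pair R n)]_t _) muE.
rewrite (ge0_integral_pushforward (@measurable_cons_pair R n)
  (product_sigma_finite leb2_measure mu))//; last 2 first.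
  - by apply/measurable_EFinP; exact: measurable_prod_tnth.
  - by move=> t _; rewrite lee_fin prodr_ge0.
rewrite preimage_setT.
rewrite (eq_integral (fun xt => (h ord0 xt.1)%:E *
    (\prod_(k < n) h (lift ord0 k) (tnth xt.2 k))%:E)); last first.
  by move=> xt _; rewrite -consE.
rewrite (@fubini_tonelli1 _ _ _ _ _ leb2_measure mu)/=; last 2 first.
  - apply: emeasurable_funM.
    + exact: (measurableT_comp (mhE ord0) measurable_fst).
    + exact: (measurableT_comp mtail measurable_snd).
  - by move=> xt; rewrite mule_ge0// lee_fin prodr_ge0.
rewrite /fubini_F/= big_ord_recl.
have inner x : \int[mu]_t ((h ord0 x)%:E *
    (\prod_(k < n) h (lift ord0 k) (tnth t k))%:E) =
    (h ord0 x)%:E * \prod_(k < n) \int[leb2]_y (h (lift ord0 k) y)%:E.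
  rewrite ge0_integralZl//; last first.
    by move=> t _; rewrite lee_fin prodr_ge0.
  congr (_ * _); have := IH (fun k => h (lift ord0 k)); rewrite muE; apply.
    by move=> k; exact: mh.
  by move=> k y; exact: h0.
rewrite (eq_integral _ _ (fun x _ => inner x)) ge0_integralZr//; first exact: mhE.
apply: (big_ind (fun y => 0 <= y)) => // [|k _]; first exact: mule_ge0.
by apply: integral_ge0 => y _; exact: h0E.
Qed.

Lemma powerE (A : set (plane R)) n :
  @power R A n = \bigcap_(k in [set: 'I_n]) ((@tnth n (plane R))^~ k @^-1` A).
Proof. by apply/seteqP; split=> [t tA k _|t tA k]; [exact: tA|exact: (tA k)]. Qed.

Lemma measurable_power (A : set (plane R)) n :
  measurable A -> measurable (@power R A n : set (n.-tuple (plane R))).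
Proof.
move=> mA; rewrite powerE; apply: fin_bigcap_measurable; first exact: finite_finset.
by move=> k _; rewrite -[X in measurable X]setTI; exact: measurable_tnth.
Qed.

(** The indicator of a power of [A] is the product of the indicators of [A] at
    the coordinates, and can be distributed over the factors. *)
Lemma integral_lebn_prod n (A : set (plane R)) (h : 'I_n -> plane R -> R) :
  measurable A -> (forall k, measurable_fun setT (h k)) ->
  (forall k x, 0 <= h k x)%R ->
  \int[@lebn R n]_(t in @power R A n) (\prod_(k < n) h k (tnth t k))%:E =
  \prod_(k < n) \int[leb2]_(x in A) (h k x)%:E.
Proof.
move=> mA mh h0.
pose hA k x := (h k x * \1_A x)%R.
have restrE (T : Type) (B : set T) (f : T -> R) :
    (EFin \o f) \_ B = (EFin \o (fun x => f x * \1_B x)%R).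
  apply/funext => x; rewrite /= patchE indicE.
  by case: ifP => _; rewrite ?mulr1 ?mulr0.
have [mu muE] := lebn_sigma_finite (R := R) n.
transitivity (\int[@lebn R n]_t ((\prod_(k < n) h k (tnth t k))%R * \1_(@power R A n) t)%:E).
  by rewrite muE integral_mkcond restrE.
transitivity (\prod_(k < n) \int[leb2]_x (hA k x)%:E); last first.
  apply: eq_bigr => k _.
  have := @integral_mkcond _ _ R leb2_measure A (EFin \o h k).
  by rewrite restrE => ->.
rewrite -(integral_lebn_prodT (h := hA)); last 2 first.
- by move=> k; apply: measurable_funM => //; exact: measurable_indic.
- by move=> k x; rewrite mulr_ge0.
rewrite muE; apply: eq_integral => t _ /=; congr (_%:E).
rewrite big_split/=; congr (_ * _)%R.
rewrite indicE; have [/set_mem tA|/negP tA] := boolP (t \in @power R A n).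
  by rewrite big1// => k _; rewrite indicE mem_set//; exact: tA.
have [k kA] : exists k, ~ A (tnth t k).
  by apply/existsNP => tA'; apply: tA; rewrite inE.
by rewrite (bigD1 k)//= indicE memNset// mul0r.
Qed.

End lebesgue_power_integral.

(** * The event that a diagram lies in a Borel set *)

Section borel_diagrams_of_subsets.
Context {R : realType}.
Implicit Types (A B U : set (plane R)) (S : diagram R) (M : nat).

Definition tally A (s : seq (R * R)) : nat := count (mem A) s.

Definition at_least M A k : set (diagram R) :=
  [set S | diagrams_le M S /\ (k <= tally A (enum_mset S))%N].

Lemma perm_tally A (s t : seq (R * R)) : perm_eq s t -> tally A s = tally A t.
Proof. by move=> /permP; apply. Qed.

Lemma le_tally A B s : A `<=` B -> (tally A s <= tally B s)%N.
Proof. by move=> AB; apply: sub_count => x /set_mem Ax; apply/mem_set/AB. Qed.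

Lemma tallyD A B s : B `<=` A ->
  tally (A `\` B) s = (tally A s - tally B s)%N.
Proof.
move=> BA; apply/esym/eqP; rewrite -(eqn_add2l (tally B s)).
rewrite subnKC ?le_tally//; apply/eqP.
elim: s => //= x s ->; rewrite addnACA; congr addn.
rewrite in_setD; have [xB|xB] := boolP (x \in B); last by rewrite andbT.
by rewrite andbF mem_set//; apply: BA; exact: set_mem.
Qed.

(** A list has finitely many entries, so an increasing union captures those it
    will ever capture at a finite stage. *)
Lemma tally_bigcup (F : (set (plane R))^nat) s : nondecreasing_seq F ->
  exists n, tally (\bigcup_i F i) s = tally (F n) s.
Proof.
move=> ndF; elim: s => [|x s [n IH]]; first by exists 0%N.
have [xF|xF] := boolP (x \in \bigcup_i F i); last first.
  exists n; rewrite /tally/= -/(tally _ s) IH; congr (nat_of_bool _ + _)%N.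
  rewrite (negbTE xF); apply/esym/negbTE; apply: contra xF.
  by move=> /set_mem xFn; apply/mem_set; exists n.
have [m _ xFm] := set_mem xF.
exists (maxn n m); apply/eqP; rewrite eqn_leq; apply/andP; split; last first.
  by apply: le_tally; exact: bigcup_sup.
rewrite /tally/= -/(tally _ s) -/(tally (F _) s) IH leq_add//.
  by rewrite xF mem_set//; have /subsetPset := ndF _ _ (leq_maxr n m); apply.
by apply: le_tally; apply/subsetPset/ndF/leq_maxl.
Qed.

Lemma diagrams_le_seq_mset M n (t : n.-tuple (R * R)) :
  (n <= M)%N -> power wedge t -> diagrams_le M (seq_mset t).
Proof.
move=> nM tW; have tt := perm_eq_seq_mset t; split => [|x /=].
  by rewrite (perm_size tt) size_tuple.
by rewrite (perm_mem tt) => /tnthP[i ->]; exact: tW.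
Qed.

(** That some [k] of the coordinates lie in an open set is an open condition on
    tuples, and invariant under permutations. *)
Lemma open_at_least M (U : set (R * R)) k : open U -> open_diagrams M (at_least M U k).
Proof.
move=> oU; split => [S []//|N NM].
exists [set f : prod_topology (fun _ : 'I_N => (R * R)%type) |
  exists2 I : {set 'I_N}, (k <= #|I|)%N & forall i, i \in I -> U (f i)].
  rewrite openE => f [I kI fI].
  pose P (i : 'I_N) : set (prod_topology (fun _ : 'I_N => (R * R)%type)) :=
    [set g | i \in I -> U (g i)].
  suff : nbhs f [set g | forall i, P i g] by apply: filterS => g gU; exists I.
  apply: (@filter_forall _ _ P (nbhs f) (nbhs_filter f)) => i.
  have [iI|iI] := boolP (i \in I); last first.
    by apply: filterS filterT => g _ /=; rewrite /P/= (negbTE iI).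
  have nU : nbhs f (@proj 'I_N (fun=> (R * R)%type) i @^-1` U).
    by apply: proj_continuous; exact: open_nbhs_nbhs (conj oU (fI _ iI)).
  by apply: (filterS _ nU) => g Ug _.
move=> t tW; rewrite /at_least/= (perm_tally _ (perm_eq_seq_mset t)).
have -> : tally U t = #|[set i | tnth t i \in U]%SET|.
  by rewrite /tally -sum1_count big_tuple -sum1_card; apply: eq_bigl => i; rewrite inE.
split=> [[_ kt]|[I kI IU]].
  by eexists; [exact: kt|move=> i; rewrite inE => /set_mem].
split; first exact: diagrams_le_seq_mset.
apply: (leq_trans kI); apply: subset_leq_card; apply/fintype.subsetP => i iI.
by rewrite inE; apply/mem_set/IU.
Qed.

Lemma borel_diagrams_sub M X : borel_diagrams M X -> X `<=` @diagrams_le R M.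
Proof.
move=> /(_ [set X | X `<=` diagrams_le M]); apply; split=> [|Y [Yle _] //].
split=> [|Y YM|F FM]; [exact: sub0set|exact: subDsetl|].
by apply: bigcup_sub => n _; exact: FM.
Qed.

Lemma borel_diagramsI M X Y : borel_diagrams M X -> borel_diagrams M Y ->
  borel_diagrams M (X `&` Y : set (diagram R)).
Proof.
by have [_ _ _] := (sigma_algebraP (@borel_diagrams_sub M)).1
  (smallest_sigma_algebra _ _); apply.
Qed.

Lemma borel_diagramsD M X Y : borel_diagrams M X -> borel_diagrams M Y ->
  borel_diagrams M (X `\` Y : set (diagram R)).
Proof.
move=> bX bY; rewrite (_ : X `\` Y = X `&` (diagrams_le M `\` Y)).
  by apply: borel_diagramsI => //; exact: sigma_algebraCD.
by rewrite setIDA (setIidl (borel_diagrams_sub bX)).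
Qed.

(** The index [j] bounds the number of points in [B] from above; a diagram of the
    left-hand side is found at the index equal to that number. *)
Lemma at_least_setD M A B k : B `<=` A -> at_least M (A `\` B) k =
  \bigcup_j (at_least M A (k + j) `\` at_least M B j.+1).
Proof.
move=> BA; apply/seteqP; split=> [S [SM kS]|S [j _ [[SM kS] SB]]].
  exists (tally B (enum_mset S)) => //; split.
    split=> //; rewrite -(subnK (le_tally (enum_mset S) BA)) leq_add2r.
    by rewrite -tallyD.
  by case=> _; rewrite ltnn.
split=> //; rewrite tallyD// leq_subRL ?le_tally// addnC (leq_trans _ kS)// leq_add2l.
by rewrite leqNgt; apply/negP => SBj; exact: SB.
Qed.

Lemma sub_measurable_sigma_open :
  (measurable : set (set (plane R))) `<=` <<s [set U : set (R * R) | open U] >>.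
Proof.
pose T := g_sigma_algebraType [set U : set (R * R) | open U].
have mfst : measurable_fun [set: T] (fst : T -> measurableTypeR R).
  apply: (measurability _ (RGenOpens.measurableE R)) => _ [_ [a [b ->]] <-].
  rewrite setTI; apply: sub_sigma_algebra; apply: open_comp.
    by move=> x _; exact: cvg_fst.
  exact: interval_open.
have msnd : measurable_fun [set: T] (snd : T -> measurableTypeR R).
  apply: (measurability _ (RGenOpens.measurableE R)) => _ [_ [a [b ->]] <-].
  rewrite setTI; apply: sub_sigma_algebra; apply: open_comp.
    by move=> x _; exact: cvg_snd.
  exact: interval_open.
rewrite measurable_prod_measurableType; apply: smallest_sub.
  exact: smallest_sigma_algebra.
move=> _ [A mA [B mB] <-].
have := measurableI _ _ (mfst measurableT _ mA) (msnd measurableT _ mB).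
by rewrite !setTI.
Qed.

(** The sets [A] for which all these counting events are Borel form a
    lambda-system containing the open sets. Counting is what makes the family
    stable under differences: the event of lying in [A] does not determine the
    event of lying in the complement of [A], whereas the counts subtract. *)
Lemma borel_at_least M A k : measurable A -> borel_diagrams M (at_least M A k).
Proof.
move=> mA.
pose H := [set B : set (R * R) | forall k, borel_diagrams M (at_least M B k)].
suff : H A by apply.
apply: (@lambda_system_subset _ [set U : set (R * R) | open U] _ setT) => //.
- by move=> U V; exact: openI.
- split=> // [j|B C CB HB HC j|F ndF HF j].
  + by apply: sub_sigma_algebra; exact: open_at_least openT.
  + rewrite at_least_setD//; apply: sigma_algebra_bigcup => i.
    by apply: borel_diagramsD; [exact: HB|exact: HC].
  + rewrite (_ : at_least M _ j = \bigcup_i at_least M (F i) j).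
      by apply: sigma_algebra_bigcup => i; exact: HF.
    apply/seteqP; split=> [S [SM jS]|S [i _ [SM jS]]].
      have [n nE] := tally_bigcup (enum_mset S) ndF.
      by exists n => //; split=> //; rewrite -nE.
    split=> //; apply: (leq_trans jS); apply: le_tally; exact: bigcup_sup.
- by move=> U oU j; apply: sub_sigma_algebra; exact: open_at_least.
- exact: sub_measurable_sigma_open.
Qed.

Definition inside M A : set (diagram R) :=
  [set S | diagrams_le M S /\ [set` S] `<=` A].

Lemma borel_inside M A : measurable A -> borel_diagrams M (inside M A).
Proof.
move=> mA; have -> : inside M A = diagrams_le M `\` at_least M (~` A) 1.
  apply/seteqP; split=> [S [SM SA]|S [SM SA]]; split=> //.
    case=> _; rewrite -has_count => /hasP[x xS /set_mem]; apply.
    exact: SA.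
  move=> x xS; apply: contrapT => Ax; apply: SA; split=> //.
  by rewrite -has_count; apply/hasP; exists x => //; exact/mem_set.
apply: sigma_algebraCD; apply: borel_at_least; exact: measurableC.
Qed.

End borel_diagrams_of_subsets.

(** * The Gaussian densities *)

Section gaussian_densities.
Context {R : realType}.
Implicit Types (sigma : R) (c x : R * R) (A : set (plane R)).
Local Notation above_diagonal := [set x : R * R | (x.1 < x.2)%R].

Lemma measurable_above_diagonal : measurable (above_diagonal : set (plane R)).
Proof.
have := @measurable_fun_ltr _ (plane R) R setT fst snd measurable_fst measurable_snd
  measurableT [set true] I.
by rewrite setTI; congr measurable; apply/seteqP; split=> x /=.
Qed.

Lemma measurable_wedge : measurable (wedge : set (plane R)).
Proof.
rewrite (_ : wedge = (fst @^-1` `[0, +oo[%classic) `&` above_diagonal).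
  apply: measurableI; last exact: measurable_above_diagonal.
  by rewrite -[X in measurable X]setTI; exact: measurable_fst.
by apply/seteqP; split=> x /=; rewrite in_itv/= andbT.
Qed.

Lemma measurable_gauss2 sigma c :
  measurable_fun [set: plane R] (gauss2 sigma c : plane R -> R).
Proof.
apply: measurable_funM.
  exact: (measurableT_comp (measurable_normal_pdf _ _) measurable_fst).
exact: (measurableT_comp (measurable_normal_pdf _ _) measurable_snd).
Qed.

Lemma gauss2_ge0 sigma c x : 0 <= gauss2 sigma c x.
Proof. by rewrite mulr_ge0 ?normal_pdf_ge0. Qed.

Lemma gauss2_gt0 sigma c x : sigma != 0 -> 0 < gauss2 sigma c x.
Proof.
move=> s0; rewrite /gauss2 !normal_pdfE//.
by rewrite !mulr_gt0 ?normal_peak_gt0 ?expR_gt0.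
Qed.

Local Open Scope ereal_scope.

Lemma integral_gauss2 sigma c : \int[leb2]_x (gauss2 sigma c x)%:E = 1.
Proof.
rewrite (@fubini_tonelli1 _ _ _ _ _ lebesgue_measure lebesgue_measure)/=.
- rewrite /fubini_F -[RHS](integral_normal_pdf c.1 sigma).
  apply: eq_integral => x _ /=.
  under eq_integral => y _ do rewrite /gauss2/= EFinM.
  rewrite ge0_integralZl//=; first by rewrite integral_normal_pdf// mule1.
  + by apply/measurable_EFinP; exact: measurable_normal_pdf.
  + by move=> y _; rewrite lee_fin normal_pdf_ge0.
  + by rewrite lee_fin normal_pdf_ge0.
- by apply/measurable_EFinP; exact: measurable_gauss2.
- by move=> x; rewrite lee_fin gauss2_ge0.
Qed.

Lemma upper_weightE sigma c :
  \int[leb2]_(x in above_diagonal) (gauss2 sigma c x)%:E = (upper_weight sigma c)%:E.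
Proof.
rewrite fineK// ge0_fin_numE; last first.
  by apply: integral_ge0 => x _; rewrite lee_fin gauss2_ge0.
apply: (@le_lt_trans _ _ 1); last exact: ltry.
rewrite -(integral_gauss2 sigma c); apply: (@ge0_subset_integral _ _ _ leb2_measure) => //.
- exact: measurable_above_diagonal.
- by apply/measurable_EFinP; exact: measurable_gauss2.
- by move=> x _; rewrite lee_fin gauss2_ge0.
Qed.

Lemma upper_weight_ge0 sigma c : (0 <= upper_weight sigma c)%R.
Proof.
by apply: fine_ge0; apply: integral_ge0 => x _; rewrite lee_fin gauss2_ge0.
Qed.

(** If the weight were 1, the Gaussian, which is positive everywhere, would vanish
    almost everywhere on the complementary half-plane, whereas that half-plane
    contains a unit square. Strictness is needed because the weights
    divide by the factors [1 - q]. *)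
Lemma upper_weight_lt1 sigma c : sigma != 0%R -> (upper_weight sigma c < 1)%R.
Proof.
move=> s0; set H := above_diagonal.
have mg : measurable_fun setT (EFin \o gauss2 sigma c : plane R -> \bar R).
  by apply/measurable_EFinP; exact: measurable_gauss2.
have g0 x : 0 <= (gauss2 sigma c x)%:E by rewrite lee_fin gauss2_ge0.
have mCH : measurable (~` H : set (plane R)).
  by apply: measurableC; exact: measurable_above_diagonal.
have split1 : (upper_weight sigma c)%:E +
    \int[leb2]_(x in ~` H) (gauss2 sigma c x)%:E = 1.
  rewrite -(upper_weightE sigma c) -(integral_gauss2 sigma c) -(setvU H) setUC.
  rewrite (@ge0_integral_setU _ _ _ leb2_measure)//.
  - exact: measurable_above_diagonal.
  - by rewrite setUC setvU.
  - by apply/disj_setPS; rewrite setICr.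
rewrite -lte_fin -split1 lteDl// lt0e integral_ge0// andbT.
apply/eqP => int0.
have /(@ae_eq_integral_abs _ _ _ leb2_measure)[] :
    \int[leb2]_(x in ~` H) `|(gauss2 sigma c x)%:E| = 0.
  by under eq_integral => x _ do rewrite gee0_abs//.
- exact: mCH.
- exact: measurable_funTS mg.
move=> N [mN N0 HN].
pose rect : set (plane R) := `[1%R, 2%R]%classic `*` `[0%R, 1%R]%classic.
have rectN : rect `<=` N.
  move=> x [] /=; rewrite !in_itv/= => /andP[x1 _] /andP[_ x2].
  apply: HN => /= gx0; have := gauss2_gt0 c x s0.
  have Hx : ~ (x.1 < x.2)%R by apply/negP; rewrite -leNgt (le_trans x2).
  by have [->] := gx0 Hx; rewrite ltxx.
have mrect : measurable rect by apply: measurableX; exact: measurable_itv.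
have : (leb2_measure rect <= leb2_measure N) by apply: le_measure; rewrite ?inE.
rewrite N0 /= product_measure1E//= !lebesgue_measure_itv/= !lte_fin.
rewrite ltr01 ltrDl ltr01 -!EFinD -EFinM lee_fin subr0 mulr1.
by rewrite lerBlDr add0r lern1.
Qed.

Local Notation integrable2 h :=
  (leb2_measure.-integrable [set: plane R] (EFin \o (h : plane R -> R))).

Lemma integrable_gauss2 sigma c : integrable2 (gauss2 sigma c).
Proof.
apply/integrableP; split; first by apply/measurable_EFinP; exact: measurable_gauss2.
under eq_integral => x _ do rewrite gee0_abs/= ?lee_fin ?gauss2_ge0//.
by have -> := integral_gauss2 sigma c; rewrite ltry.
Qed.

Lemma integrable2Z (k : R) (h : R * R -> R) :
  integrable2 h -> integrable2 (fun x => k * h x)%R.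
Proof.
move=> ih; rewrite (_ : _ \o _ = (fun x : plane R => k%:E * (h x)%:E)) //.
exact: (@integrableZl _ _ _ leb2_measure).
Qed.

Lemma integrable2_indic (D : set (plane R)) (h : R * R -> R) : measurable D ->
  integrable2 h -> integrable2 (fun x => h x * \1_D x)%R.
Proof.
move=> mD ih; have /integrableP[/measurable_EFinP mh _] := ih.
apply: (le_integrable _ _ _ ih) => //.
  apply/measurable_EFinP; apply: measurable_funM => //; exact: measurable_indic.
move=> x _ /=; rewrite lee_fin normrM indicE normr_nat ler_piMr//.
by rewrite lern1 leq_b1.
Qed.

Lemma integral_fin_num (h : R * R -> R) A : measurable A -> integrable2 h ->
  \int[leb2]_(x in A) (h x)%:E \is a fin_num.
Proof.
move=> mA ih; apply: (@integrable_fin_num _ _ _ leb2_measure) => //.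
exact: (@integrableS _ _ _ leb2_measure setT).
Qed.

Lemma upper_density_ge0 sigma c x : (0 <= upper_density sigma c x)%R.
Proof.
rewrite /upper_density mulr_ge0// mulr_ge0 ?gauss2_ge0// invr_ge0.
by apply: fine_ge0; apply: integral_ge0 => y _; rewrite lee_fin gauss2_ge0.
Qed.

Lemma integrable_upper_density sigma c : integrable2 (upper_density sigma c).
Proof.
rewrite /upper_density; apply: integrable2_indic; first exact: measurable_wedge.
under eq_fun do rewrite mulrC.
by apply: integrable2Z; exact: integrable_gauss2.
Qed.

(** The exponential is the Gaussian centered at the projection of a feature onto
    the diagonal, up to a factor 2: the prefactor normalizes it on a half-plane
    bounded by the diagonal. *)
Lemma lower_kernelE sigma (mu : R) x : sigma != 0%R ->
  ((pi * sigma ^+ 2)^-1 *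
   expR (- ((x.1 - mu) ^+ 2 + (x.2 - mu) ^+ 2) / (2 * sigma ^+ 2)) =
   2 * gauss2 sigma (mu, mu) x)%R.
Proof.
move=> s0; rewrite /gauss2 !normal_pdfE//= /normal_peak /normal_fun.
have s20 : (0 < sigma ^+ 2 * pi *+ 2 :> R)%R.
  by rewrite mulrn_wgt0// mulr_gt0 ?pi_gt0// exprn_even_gt0.
rewrite [X in _ = (2 * X)%R]mulrACA [RHS]mulrA -expRD -invfM -expr2 sqr_sqrtr ?ltW//.
congr (_ * expR _)%R.
  by rewrite -[X in _ = (2 * X^-1)%R]mulr_natl [RHS]mulrC [in RHS]invfM mulrAC
    mulVf// mul1r mulrC.
by rewrite -mulrDl -opprD mulr_natl.
Qed.

Lemma lower_shape_ge0 sigma (L : diagram R) x : (0 <= lower_shape sigma L x)%R.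
Proof.
rewrite /lower_shape mulr_ge0// mulr_ge0 ?invr_ge0// sumr_ge0// => c _.
by rewrite mulr_ge0 ?expR_ge0// invr_ge0 mulr_ge0 ?pi_ge0 ?sqr_ge0.
Qed.

Lemma integrable_lower_shape sigma (L : diagram R) : sigma != 0%R ->
  integrable2 (lower_shape sigma L).
Proof.
move=> s0; rewrite /lower_shape.
under eq_fun do rewrite mulrC.
apply: integrable2_indic; first exact: measurable_wedge.
apply: integrable2Z.
under eq_fun => x do under eq_bigr => c _ do rewrite lower_kernelE//.
rewrite (_ : _ \o _ = (fun x : plane R => \sum_(c <- enum_mset L)
    (2 * gauss2 sigma ((c.1 + c.2) / 2, (c.1 + c.2) / 2) x)%:E)).
  apply: (@integrable_sum _ _ _ leb2_measure) => // c _.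
  by apply: integrable2Z; exact: integrable_gauss2.
by apply/funext => x /=; rewrite sumEFin.
Qed.

Lemma lower_densityE sigma (L : diagram R) : lower_density sigma L =
  (fun x => (fine (\int[leb2]_(y in wedge) (lower_shape sigma L y)%:E))^-1 *
             lower_shape sigma L x)%R.
Proof. by apply/funext => x; rewrite mulrC. Qed.

Lemma lower_density_ge0 sigma (L : diagram R) x : (0 <= lower_density sigma L x)%R.
Proof.
rewrite lower_densityE mulr_ge0 ?lower_shape_ge0// invr_ge0.
by apply: fine_ge0; apply: integral_ge0 => y _; rewrite lee_fin lower_shape_ge0.
Qed.

Lemma integrable_lower_density sigma (L : diagram R) : sigma != 0%R ->
  integrable2 (lower_density sigma L).
Proof.
by move=> s0; rewrite lower_densityE; apply: integrable2Z; exact: integrable_lower_shape.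
Qed.

(** An inequality rather than an equality, as the total mass is 0 when there are
    no lower features. *)
Lemma integral_lower_density_le1 sigma (L : diagram R) : sigma != 0%R ->
  \int[leb2]_(x in wedge) (lower_density sigma L x)%:E <= 1.
Proof.
move=> s0; rewrite lower_densityE.
set I := \int[leb2]_(y in wedge) (lower_shape sigma L y)%:E.
have ish := integrable_lower_shape L s0.
have Ifin : I \is a fin_num by apply: integral_fin_num => //; exact: measurable_wedge.
have I0 : 0 <= I by apply: integral_ge0 => y _; rewrite lee_fin lower_shape_ge0.
under eq_integral => x _ do rewrite EFinM.
rewrite (@ge0_integralZl _ _ _ leb2_measure)//.
- rewrite -/I -[X in _ * X](fineK Ifin) -EFinM lee_fin.
  by have [->|I1] := eqVneq (fine I) 0%R; rewrite ?mulr0// mulVf.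
- exact: measurable_wedge.
- have /integrableP[mf _] := ish; exact: measurable_funTS mf.
- by move=> x _; rewrite lee_fin lower_shape_ge0.
- by rewrite lee_fin invr_ge0 fine_ge0.
Qed.

End gaussian_densities.

(** * Increasing injections as subsets *)

Section increasing_injections.

Lemma increasingP j n (g : {ffun 'I_j -> 'I_n}) :
  reflect (forall a b : 'I_j, (a < b)%N -> (g a < g b)%N) (increasing g).
Proof.
apply: (iffP forallP) => [inc a b ab|inc a].
  by have /forallP/(_ b)/implyP := inc a; exact.
by apply/forallP => b; apply/implyP; exact: inc.
Qed.

Lemma increasing_inj j n (g : {ffun 'I_j -> 'I_n}) : increasing g -> injective g.
Proof.
move=> /increasingP inc a b /(congr1 val) gab.
by apply/val_inj/eqP; case: ltngtP => // /inc; rewrite gab ltnn.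
Qed.

Lemma sorted_codom_increasing j n (g : {ffun 'I_j -> 'I_n}) :
  increasing g -> sorted ltn (map val (codom g)).
Proof.
move=> /increasingP inc; rewrite -map_comp sorted_map.
have : sorted (relpre val ltn) (enum 'I_j).
  by rewrite -sorted_map val_enum_ord iota_ltn_sorted.
by apply: sub_sorted => a b; exact: inc.
Qed.

Lemma increasing_image_inj j n :
  {in @increasing j n &, injective (fun g : {ffun 'I_j -> 'I_n} => [set g a | a : 'I_j]%SET)}.
Proof.
move=> g h ginc hinc gh; apply/ffunP => a.
have codomE : codom g = codom h.
  apply: (inj_map val_inj).
  apply: (irr_sorted_eq ltn_trans ltnn); rewrite ?sorted_codom_increasing// => x.
  have memE (f : {ffun 'I_j -> 'I_n}) : (x \in map val (codom f)) =
      (x \in map val (enum [set f a | a : 'I_j]%SET)).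
    apply/mapP/mapP => -[i fi ->]; exists i => //; rewrite ?mem_enum.
      by have /codomP[b ->] := fi; exact: imset_f.
    by move: fi; rewrite mem_enum => /imsetP[b _ ->]; exact: codom_f.
  by rewrite !memE gh.
by have /eq_in_map := codomE; apply; rewrite mem_enum.
Qed.

(** Together with injectivity: an increasing injection is the increasing
    enumeration of its image. *)
Lemma increasing_image j n :
  [set [set g a | a : 'I_j]%SET | g : {ffun 'I_j -> 'I_n} in @increasing j n]%SET =
  [set J : {set 'I_n} | #|J| == j]%SET.
Proof.
apply/setP => J; rewrite inE; apply/imsetP/eqP => [[g ginc ->]|<-].
  by rewrite card_imset ?card_ord//; exact: increasing_inj.
exists [ffun k : 'I_#|J| => enum_val k].
  apply/increasingP => a b ab; rewrite !ffunE.
  have sJ : sorted ltn (map val (enum J)).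
    rewrite sorted_map [X in enum_mem X]/= /enum_mem; apply: sorted_filter.
      by move=> x y z; exact: ltn_trans.
    by rewrite -enumT -sorted_map val_enum_ord iota_ltn_sorted.
  have i0 := enum_val a.
  rewrite !(enum_val_nth i0) -!(nth_map i0 0%N) -?cardE//.
  by apply: (sorted_ltn_nth ltn_trans) => //; rewrite inE size_map -cardE.
apply/setP => i; apply/idP/imsetP => [iJ|[k _ ->]].
  by exists (enum_rank_in iJ i) => //; rewrite ffunE enum_rankK_in.
by rewrite ffunE; exact: enum_valP.
Qed.

Lemma sum_increasing (V : nmodType) n (F : {set 'I_n} -> V) :
  \sum_(j < n.+1) \sum_(g : {ffun 'I_j -> 'I_n} | increasing g)
    F [set g a | a : 'I_j]%SET = \sum_(J : {set 'I_n}) F J.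
Proof.
have cardJ (J : {set 'I_n}) : (#|J| < n.+1)%N.
  by rewrite ltnS -[X in (_ <= X)%N]card_ord max_card.
rewrite [RHS](partition_big (fun J => Ordinal (cardJ J)) xpredT)//=.
apply: eq_bigr => j _.
rewrite -(big_imset (h := fun g : {ffun 'I_j -> 'I_n} => [set g a | a : 'I_j]%SET) F)/=.
  by rewrite increasing_image; apply: eq_bigl => J; rewrite inE.
exact: increasing_image_inj.
Qed.

(** Expanding the product amounts to choosing the set of indices that contribute
    [q i * a i]; the image of [g] is this set, and [Qstar q g] is the product of
    the factors [1 - q i] over its complement. *)
Lemma prod_choice_increasing (R : realType) n (q a : 'I_n -> R) :
  (forall i, q i != 1) ->
  \prod_(i < n) (1 - q i + q i * a i) =
  \sum_(j < n.+1) \sum_(g : {ffun 'I_j -> 'I_n} | increasing g)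
    Qweight q g * \prod_(k < j) a (g k).
Proof.
move=> q1; under eq_bigr do rewrite addrC.
rewrite bigA_distr -sum_increasing.
apply: eq_bigr => j _; apply: eq_bigr => g /increasing_inj ginj.
have prodE (phi : 'I_n -> R) :
    \prod_(k < j) phi (g k) = \prod_(i in [set g a | a : 'I_j]%SET) phi i.
  by rewrite big_imset//; apply: in2W.
rewrite /Qweight /Qstar (prodE (fun i => 1 - q i)) (prodE q) (prodE a).
rewrite (bigID [in [set g a | a : 'I_j]%SET])/=.
rewrite [X in _ = X / _ * _ * _](bigID [in [set g a | a : 'I_j]%SET])/=.
rewrite [X in _ = X / _ * _ * _]mulrC mulfK; last first.
  by apply/prodf_neq0 => i _; rewrite subr_eq0 eq_sym.
rewrite mulrC -mulrA -big_split/=; congr (_ * _).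
  by apply: eq_bigr => i /negbTE ->.
by apply: eq_bigr => i ->.
Qed.

End increasing_injections.

(** * Belief functions of the upper and lower diagrams *)

Section unions_of_diagrams.
Context {R : realType}.
Implicit Types (S T : diagram R) (A : set (R * R)).

Lemma size_msetD S T : size (msetD S T) = (size S + size T)%N.
Proof.
rewrite -size_cat; apply: perm_size; apply/allP => x _ /=.
by rewrite count_cat !count_mem_mset msetE2.
Qed.

Lemma subset_msetD S T A :
  [set` msetD S T] `<=` A <-> [set` S] `<=` A /\ [set` T] `<=` A.
Proof.
split=> [STA|[SA TA] x /=].
  by split=> x /= xST; apply: STA; rewrite /= in_msetD xST ?orbT.
by rewrite in_msetD => /orP[/SA|/TA].
Qed.

Lemma subset_mset0 A : [set` (mset0 : diagram R)] `<=` A.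
Proof. by move=> x /=; rewrite in_mset0. Qed.

Lemma subset_big_msetD n (F : 'I_n -> diagram R) A :
  [set` \big[msetD/mset0]_(j < n) F j] `<=` A <-> forall j, [set` F j] `<=` A.
Proof.
elim: n F => [|n IH] F; first by rewrite big_ord0; split=> [_ []//|_]; exact: subset_mset0.
rewrite big_ord_recl subset_msetD IH; split=> [[F0 FS] j|FA]; last by split.
by case: (unliftP ord0 j) => [k|] ->.
Qed.

Lemma size_big_msetD n (F : 'I_n -> diagram R) :
  size (\big[msetD/mset0]_(j < n) F j) = (\sum_(j < n) size (F j))%N.
Proof.
by elim/big_rec2: _ => [|j k S _ <-]; rewrite ?size_mset0 ?size_msetD.
Qed.

Lemma diagrams_le_big_msetD n (F : 'I_n -> diagram R) :
  (forall j, diagrams_le 1 (F j)) -> diagrams_le n (\big[msetD/mset0]_(j < n) F j).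
Proof.
move=> F1; split; last by apply/subset_big_msetD => j; have [] := F1 j.
rewrite size_big_msetD -[X in (_ <= X)%N]card_ord -sum1_card.
by apply: leq_sum => j _; have [] := F1 j.
Qed.

Lemma size1_mset S : size S = 1%N -> exists x, S = [mset x]%mset.
Proof.
move=> S1; exists (head (0, 0) S); rewrite -[LHS]seq_mset_id -[RHS]seq_mset_id.
by rewrite enum_msetn/=; case: (enum_mset S) S1 => [|x []].
Qed.

Lemma subset_mset1 x A : [set` [mset x]%mset] `<=` A <-> A x.
Proof.
split=> [|Ax y /=]; last by rewrite in_mset1 => /eqP ->.
by apply; rewrite /= in_mset1.
Qed.

End unions_of_diagrams.

Section beliefs.
Context {R : realType} {d : measure_display} {Omega : measurableType d}.
Variable P : probability Omega R.
Implicit Types (A : set (plane R)) (X : Omega -> diagram R).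
Local Open Scope ereal_scope.

Lemma preimage_inside M A X : (forall w, diagrams_le M (X w)) ->
  X @^-1` inside M A = [set w | [set` X w] `<=` A].
Proof.
by move=> XM; apply/seteqP; split=> [w []//|w XA]; split.
Qed.

Lemma measurable_subset M A X : random_diagram M X -> measurable A ->
  measurable [set w | [set` X w] `<=` A].
Proof.
move=> [XM mX] mA; rewrite -(preimage_inside A XM); apply: mX.
exact: borel_inside.
Qed.

(** Lying in [A] splits into being empty and having a single point, in [A]. *)
Lemma belief_singleton q (p : R * R -> R) X A :
  singleton_diagram P q p X -> measurable A -> A `<=` wedge ->
  \int[leb2]_(x in A) (p x)%:E \is a fin_num ->
  belief P X A = (1 - q + q * fine (\int[leb2]_(x in A) (p x)%:E))%:E.
Proof.
move=> [rX Xq XA] mA AW pfin; have [X1 _] := rX.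
pose Z := [set w | [set` X w] `<=` set0].
have ZE : Z = [set w | X w == mset0].
  apply/seteqP; split=> w /=; last by rewrite /Z/= => /eqP ->; exact: subset_mset0.
  move=> X0; apply/eqP/msetP => x; rewrite mset0E; apply/eqP; rewrite mset_eq0.
  by apply/negP => /X0.
have mZ : measurable Z by apply: (measurable_subset rX); exact: measurable0.
have Z1 : P Z = (1 - q)%:E.
  have -> : Z = ~` [set w | X w != mset0].
    by rewrite ZE; apply/seteqP; split=> w /=; [move=> /eqP ->; rewrite eqxx|move=> /negP/negPn].
  rewrite probability_setC; first by rewrite Xq.
  rewrite (_ : [set w | _] = ~` Z); first exact: measurableC.
  by rewrite ZE; apply/seteqP; split=> w /= /negP.
have Pq : P [set w | size (X w) = 1%N] = q%:E.
  rewrite -Xq; congr (P _); apply/seteqP; split=> w /=; rewrite -size_mset_eq0.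
    by move=> ->.
  by have [] := X1 w; case: (size (X w)) => [|[]].
pose E := [set w | exists2 x, A x & X w = [mset x]%mset].
have EE : E = [set w | [set` X w] `<=` A] `\` Z.
  apply/seteqP; split=> w /=.
    move=> [x Ax Xx]; rewrite Xx; split; first exact/subset_mset1.
    by rewrite /Z/= Xx => /subset_mset1.
  move=> [XwA Xw0]; have [|x Xx] := @size1_mset R (X w).
    have [X1w _] := X1 w; apply/eqP; rewrite eqn_leq X1w lt0n size_mset_eq0.
    by apply/negP => X0; apply: Xw0; rewrite ZE.
  by exists x => //; apply/subset_mset1; rewrite -Xx.
have mXA := measurable_subset rX mA.
have mE : measurable E by rewrite EE; exact: measurableD.
have -> : belief P X A = P (Z `|` E).
  rewrite EE setDUK// => w Zw x xX; by have := Zw x xX.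
transitivity (P Z + P E).
  by rewrite measureU// EE setDE setICA setICr setI0.
by rewrite Z1 XA// Pq [in RHS]EFinD EFinM fineK.
Qed.

Lemma belief_union n (q : 'I_n -> R) (p : 'I_n -> R * R -> R)
    (X : 'I_n -> Omega -> diagram R) A :
  (forall j, singleton_diagram P (q j) (p j) (X j)) ->
  mutually_independent P 1 X -> measurable A -> A `<=` wedge ->
  (forall j, \int[leb2]_(x in A) (p j x)%:E \is a fin_num) ->
  belief P (fun w => \big[msetD/mset0]_(j < n) X j w) A =
  (\prod_(j < n) (1 - q j + q j * fine (\int[leb2]_(x in A) (p j x)%:E)))%:E.
Proof.
move=> sX iX mA AW pfin.
have X1 j w : diagrams_le 1 (X j w) by have [[]] := sX j.
rewrite -prodEFin /belief.
transitivity (P (\bigcap_(j in [set` [set: 'I_n]%SET]) X j @^-1` inside 1 A)).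
  congr (P _); apply/seteqP; split=> w.
    move=> /subset_big_msetD XA j _; split=> //; exact: XA.
  by move=> XA; apply/subset_big_msetD => j; have [] := XA j (finset.in_setT j).
rewrite (iX _ (fun=> inside 1 A)); last by move=> j _; exact: borel_inside.
rewrite (eq_bigl xpredT); last by move=> j; rewrite finset.in_setT.
apply: eq_bigr => j _; rewrite preimage_inside//.
exact: belief_singleton.
Qed.

Lemma seq_mset_insideE M A n : A `<=` wedge ->
  [set t : n.-tuple (R * R) | power wedge t /\ inside M A (seq_mset t)] =
  if (n <= M)%N then @power R A n else set0.
Proof.
move=> AW; have tP (t : n.-tuple (R * R)) : [set` seq_mset t] `<=` A <-> power A t.
  have tt := perm_eq_seq_mset t; split=> [tA i|tA x /=].
    by apply: tA; rewrite /= (perm_mem tt) mem_tnth.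
  by rewrite (perm_mem tt) => /tnthP[i ->]; exact: tA.
case: leqP => [nM|Mn]; apply/seteqP; split=> t //=.
- by move=> [_ [_ /tP]].
- move=> tA; have tW : power wedge t by move=> i; exact: AW.
  by split=> //; split; [exact: diagrams_le_seq_mset|exact/tP].
- by move=> [_ [[]]]; rewrite (perm_size (perm_eq_seq_mset t)) size_tuple leqNgt Mn.
Qed.

Lemma integral_inside M (p : R * R -> R) A b n :
  measurable_fun [set: plane R] (p : plane R -> R) -> (forall x, (0 <= p x)%R) ->
  measurable A -> A `<=` wedge -> \int[leb2]_(x in A) (p x)%:E = b%:E ->
  \int[@lebn R n]_(t in [set t | power wedge t /\ inside M A (seq_mset t)])
     (\prod_(k < n) p (tnth t k))%:E =
  (if (n <= M)%N then b ^+ n else 0)%:E.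
Proof.
move=> mp p0 mA AW pb; rewrite seq_mset_insideE//; case: ifP => _.
  rewrite (integral_lebn_prod (h := fun=> p))//.
  by rewrite (eq_bigr (fun=> b%:E))// prodEFin prodr_const card_ord.
have [mu ->] := lebn_sigma_finite (R := R) n; exact: integral_set0.
Qed.

(** The law of [Y] only sees the tuples of length at most [M], and these already
    have probability 1; the mass of a tuple length [n] being at most [nu n], no
    mass is left for the longer tuples. This matters because the values of [nu]
    beyond [M] enter the density, although they do not enter the law of [Y]. *)
Lemma iid_cardinality_le M nu (p : R * R -> R) Y b : iid_diagram P M nu p Y ->
  (forall n, 0 <= nu n)%R -> \sum_(0 <= n <oo) (nu n)%:E = 1 ->
  measurable_fun [set: plane R] (p : plane R -> R) -> (forall x, (0 <= p x)%R) ->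
  \int[leb2]_(x in wedge) (p x)%:E = b%:E -> (b <= 1)%R ->
  forall n, (M < n)%N -> nu n = 0%R.
Proof.
move=> iY nu0 nu1 mp p0 pb b1 n Mn; have [[YM _] YB] := iY.
have b0 : (0 <= b)%R.
  by rewrite -lee_fin -pb; apply: integral_ge0 => x _; rewrite lee_fin.
pose mass k := (nu k * (if (k <= M)%N then b ^+ k else 0))%R.
have mass0 k : (0 <= mass k)%R.
  by rewrite /mass; case: ifP => _; rewrite ?mulr0// mulr_ge0// exprn_ge0.
have mass_le k : (mass k <= nu k)%R.
  by rewrite /mass; case: ifP => _; rewrite ?mulr0// ler_piMr// exprn_ile1.
have mass1 : \sum_(0 <= k <oo) (mass k)%:E = 1.
  rewrite -(@probability_setT _ _ _ P).
  have -> : [set: Omega] = Y @^-1` inside M wedge.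
    by rewrite preimage_inside//; apply/seteqP; split=> w // _; have [] := YM w.
  rewrite YB; last exact: borel_inside measurable_wedge.
  apply: eq_eseriesr => k _; rewrite (integral_inside _ _ mp p0 _ _ pb)//.
  exact: measurable_wedge.
move: nu1 mass1.
rewrite (@nneseriesD1 R _ n xpredT)// => [|k _]; last by rewrite lee_fin.
rewrite (@nneseriesD1 R (fun k => (mass k)%:E) n xpredT)// => [|k _]; last by rewrite lee_fin.
rewrite {1}/mass leqNgt Mn/= mulr0 add0e => nu1 mass1.
have le1 : 1 <= \sum_(0 <= k <oo | xpredT k && (k != n)) (nu k)%:E.
  by rewrite -{1}mass1; apply: lee_nneseries => k *; rewrite lee_fin ?mass0 ?mass_le.
apply/eqP; rewrite eq_le nu0 andbT -lee_fin.
by rewrite -(leeD2rE (x := 1))// add0e -[leRHS]nu1 leeD2l.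
Qed.

Lemma belief_iid M nu (p : R * R -> R) Y A b bW : iid_diagram P M nu p Y ->
  (forall n, 0 <= nu n)%R -> \sum_(0 <= n <oo) (nu n)%:E = 1 ->
  measurable_fun [set: plane R] (p : plane R -> R) -> (forall x, (0 <= p x)%R) ->
  \int[leb2]_(x in wedge) (p x)%:E = bW%:E -> (bW <= 1)%R ->
  measurable A -> A `<=` wedge -> \int[leb2]_(x in A) (p x)%:E = b%:E ->
  belief P Y A = \sum_(0 <= n <oo) (nu n * b ^+ n)%:E.
Proof.
move=> iY nu0 nu1 mp p0 pW bW1 mA AW pA; have [[YM _] YB] := iY.
rewrite /belief -(preimage_inside A YM) YB; last exact: borel_inside.
apply: eq_eseriesr => k _; rewrite (integral_inside _ _ mp p0 mA AW pA) -EFinM.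
case: leqP => // Mk; rewrite mulr0.
by rewrite (iid_cardinality_le iY nu0 nu1 mp p0 pW bW1 Mk) mul0r.
Qed.

End beliefs.

(** * Integrals of densities over the powers of a set *)

Section integrals_of_densities.
Context {R : realType}.
Implicit Types (A : set (plane R)).
Local Open Scope ereal_scope.

(** Integrability and the value of the integral travel together, so that both are
    obtained by the same induction over sums and multiples. *)
Definition has_integral n A (F : n.-tuple (R * R) -> R) (v : R) : Prop :=
  (@lebn R n).-integrable (@power R A n) (EFin \o F) /\
  \int[@lebn R n]_(t in @power R A n) (F t)%:E = v%:E.

Lemma has_integral_sum n A (I : Type) (s : seq I) (Q : pred I)
    (F : I -> n.-tuple (R * R) -> R) (v : I -> R) : measurable A ->
  (forall i, Q i -> has_integral A (F i) (v i)) ->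
  has_integral A (fun t => \sum_(i <- s | Q i) F i t)%R (\sum_(i <- s | Q i) v i)%R.
Proof.
move=> mA; rewrite /has_integral.
have [mu ->] := lebn_sigma_finite (R := R) n => FQ.
have mpA := @measurable_power R A n mA.
have sumE : EFin \o (fun t => \sum_(i <- s | Q i) F i t)%R =
    (fun t => \sum_(i <- s | Q i) (EFin \o F i) t).
  by apply/funext => t /=; rewrite sumEFin.
split; first by rewrite sumE; apply: integrable_sum => // i /FQ[].
transitivity (\int[mu]_(t in @power R A n) \sum_(i <- s | Q i) (EFin \o F i) t).
  by apply: eq_integral => t _; rewrite /= sumEFin.
elim: s {sumE} => [|i s IH].
  by rewrite big_nil; under eq_integral do rewrite big_nil; rewrite integral0.
rewrite big_cons; case: ifP => Qi; last first.
  by rewrite -IH; apply: eq_integral => t _; rewrite big_cons Qi.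
under eq_integral do rewrite big_cons Qi.
have [iFi vi] := FQ _ Qi.
rewrite integralD//; first by rewrite IH vi -EFinD.
by apply: integrable_sum => // k /FQ[].
Qed.

Lemma has_integralZ n A (F : n.-tuple (R * R) -> R) (c v : R) : measurable A ->
  has_integral A F v -> has_integral A (fun t => c * F t)%R (c * v)%R.
Proof.
move=> mA; rewrite /has_integral.
have [mu ->] := lebn_sigma_finite (R := R) n => -[iF Fv].
have mpA := @measurable_power R A n mA.
have ZE : EFin \o (fun t => c * F t)%R = (fun t => c%:E * (EFin \o F) t) by [].
rewrite ZE; split; first exact: integrableZl.
by rewrite (integralZl mpA iF) Fv.
Qed.

Lemma has_integral0 n A : measurable A ->
  has_integral A (fun _ : n.-tuple (R * R) => 0%R) 0%R.
Proof.
move=> mA; rewrite /has_integral.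
have [mu ->] := lebn_sigma_finite (R := R) n.
by split; [exact: integrable0|rewrite integral0].
Qed.

Lemma has_integral_prod n A (h : 'I_n -> R * R -> R) (v : 'I_n -> R) :
  measurable A -> (forall k, measurable_fun [set: plane R] (h k : plane R -> R)) ->
  (forall k x, 0 <= h k x)%R ->
  (forall k, \int[leb2]_(x in A) (h k x)%:E = (v k)%:E) ->
  has_integral A (fun t => \prod_(k < n) h k (tnth t k))%R (\prod_(k < n) v k)%R.
Proof.
move=> mA mh h0 hv.
have intE : \int[@lebn R n]_(t in @power R A n) (\prod_(k < n) h k (tnth t k))%:E =
    (\prod_(k < n) v k)%:E.
  by rewrite integral_lebn_prod// -prodEFin; apply: eq_bigr => k _.
split=> //; move: intE.
have [mu ->] := lebn_sigma_finite (R := R) n => intE.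
apply/integrableP; split.
  apply/measurable_EFinP; apply: measurable_funTS; exact: measurable_prod_tnth.
under eq_integral => t _ do rewrite gee0_abs/= ?lee_fin ?prodr_ge0//.
by rewrite intE ltry.
Qed.

(** Permuting the points only permutes the factors, and the product of
    their integrals does not depend on the order. *)
Lemma has_integral_prod_permt n A (h : 'I_n -> R * R -> R) (v : 'I_n -> R)
    (s : 'S_n) :
  measurable A -> (forall k, measurable_fun [set: plane R] (h k : plane R -> R)) ->
  (forall k x, 0 <= h k x)%R ->
  (forall k, \int[leb2]_(x in A) (h k x)%:E = (v k)%:E) ->
  has_integral A (fun t => \prod_(k < n) h k (tnth (permt s t) k))%R
    (\prod_(k < n) v k)%R.
Proof.
move=> mA mh h0 hv.
have := @has_integral_prod n A (fun k => h (s^-1%g k)) (fun k => v (s^-1%g k)) mA.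
move=> /(_ (fun k => mh _) (fun k => h0 _) (fun k => hv _)).
rewrite [X in has_integral _ _ X](reindex_inj (@perm_inj _ s))/=.
under eq_bigr do rewrite permK.
congr has_integral; apply/funext => t; rewrite [LHS](reindex_inj (@perm_inj _ s))/=.
by apply: eq_bigr => k _; rewrite permK tnth_mktuple.
Qed.

(** The product of [u k] over the first [j] points and of [w] over the others is a
    product over all points of one family of functions, [pick]. *)
Lemma has_integral_split n j A (u : 'I_j -> R * R -> R) (w : R * R -> R)
    (a : 'I_j -> R) (b : R) (s : 'S_n) : (j <= n)%N -> measurable A ->
  (forall k, measurable_fun [set: plane R] (u k : plane R -> R)) ->
  (forall k x, 0 <= u k x)%R ->
  measurable_fun [set: plane R] (w : plane R -> R) -> (forall x, 0 <= w x)%R ->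
  (forall k, \int[leb2]_(x in A) (u k x)%:E = (a k)%:E) ->
  \int[leb2]_(x in A) (w x)%:E = b%:E ->
  has_integral A (fun t => (\prod_(k < j) u k (nth (0, 0) (permt s t) k)) *
    (\prod_(j <= k < n) w (nth (0, 0) (permt s t) k)))%R
    ((\prod_(k < j) a k) * b ^+ (n - j))%R.
Proof.
move=> jn mA mu u0 mw w0 ua wb.
pose pick T (f : 'I_j -> T) (x : T) (k : nat) := oapp f x (insub k).
have pickP T (f : 'I_j -> T) x (Q : T -> Prop) k :
    (forall i, Q (f i)) -> Q x -> Q (pick T f x k).
  by move=> fQ xQ; rewrite /pick; case: insub.
have prodE (T : Type) (f : 'I_j -> T) x (G : T -> nat -> R) :
    (\prod_(k < n) G (pick T f x k) k =
     (\prod_(k < j) G (f k) k) * \prod_(j <= k < n) G x k)%R.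
  rewrite -(big_mkord xpredT (fun k => G (pick T f x k) k)) (@big_cat_nat _ _ _ j 0 n)//=.
  rewrite big_mkord; congr (_ * _)%R; first by apply: eq_bigr => k _; rewrite /pick valK.
  by apply: eq_big_nat => k /andP[jk _]; rewrite /pick insubF// ltnNge jk.
have := @has_integral_prod_permt n A (fun k => pick _ u w k) (fun k => pick _ a b k) s mA.
rewrite (prodE _ a b (fun x _ => x)) prodr_const_nat.
move=> H; have : has_integral A (fun t => \prod_(k < n) pick _ u w k (tnth (permt s t) k))%R
    ((\prod_(k < j) a k) * b ^+ (n - j))%R.
  apply: H => [k|k|k].
  - by apply: pickP.
  - exact: (pickP _ _ _ (fun f => forall x, 0 <= f x)%R).
  - by rewrite /pick; case: insub.
congr has_integral; apply/funext => t.
by rewrite -(prodE _ u w (fun f k => f (nth (0, 0)%R (permt s t) k))); apply: eq_bigr => k _;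
  rewrite (tnth_nth (0, 0)%R).
Qed.

End integrals_of_densities.

(** * Summation over the number of points *)

Section cardinality_series.
Context {R : realType}.
Local Open Scope ereal_scope.

Lemma extend0_subn (nu : nat -> R) N j :
  extend0 nu (N%:Z - j%:Z) = (if (j <= N)%N then nu (N - j)%N else 0)%R.
Proof.
case: leqP => [jN|Nj]; first by rewrite subzn.
rewrite (_ : N%:Z - j%:Z = Negz (j - N).-1)%R//.
by rewrite NegzE prednK ?subn_gt0// -subzn ?opprB// ltnW.
Qed.

Lemma nneseries_shift (u : nat -> R) j : (forall n, 0 <= u n)%R ->
  \sum_(0 <= n <oo) (if (j <= n)%N then u (n - j)%N else 0)%:E =
  \sum_(0 <= n <oo) (u n)%:E.
Proof.
move=> u0; rewrite (nneseries_split _ j); last first.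
  by move=> k _; case: ifP; rewrite lee_fin.
rewrite add0n big_nat big1 => [|k /andP[_ kj]]; last by rewrite leqNgt kj.
rewrite add0e -nneseries_addn => [|k]; last by case: ifP; rewrite lee_fin.
by apply: eq_eseriesr => k _; rewrite leq_addl addnK.
Qed.

Lemma nneseries_convolution m (e : 'I_m -> R) (u : nat -> R) :
  (forall j, 0 <= e j)%R -> (forall n, 0 <= u n)%R ->
  \sum_(0 <= n <oo)
    (\sum_(j < m) e j * (if (j <= n)%N then u (n - j)%N else 0))%:E =
  (\sum_(j < m) e j)%:E * \sum_(0 <= n <oo) (u n)%:E.
Proof.
move=> e0 u0.
under eq_eseriesr => n _ do rewrite -sumEFin.
rewrite nneseries_sum; last first.
  by move=> j n _; rewrite lee_fin mulr_ge0//; case: ifP.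
rewrite -sumEFin ge0_sume_distrl; last by move=> j _; rewrite lee_fin.
apply: eq_bigr => j _; rewrite -(nneseries_shift j u0) -nneseriesZl//.
by move=> n _; case: ifP; rewrite lee_fin.
Qed.

End cardinality_series.

Lemma Qweight_ge0 (R : realType) n (q : 'I_n -> R) j (g : {ffun 'I_j -> 'I_n}) :
  (forall i, 0 <= q i <= 1) -> 0 <= Qweight q g.
Proof.
move=> q01; have q0 i : 0 <= q i by have /andP[] := q01 i.
have q1 i : 0 <= 1 - q i by rewrite subr_ge0; have /andP[] := q01 i.
by rewrite /Qweight /Qstar mulr_ge0 ?prodr_ge0// divr_ge0 ?prodr_ge0.
Qed.

(** * The density of the union *)

Section union_density.
Context {R : realType}.
Context (n : nat) (q : 'I_n -> R) (p : 'I_n -> R * R -> R).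
Context (nu : nat -> R) (pl : R * R -> R).

Definition union_density N (Z : N.-tuple (R * R)) : R :=
  \sum_(j < n.+1) extend0 nu (N%:Z - j%:Z) *
    \sum_(g : {ffun 'I_j -> 'I_n} | increasing g)
      Qweight q g * (\prod_(k < j) p (g k) (nth (0, 0) Z k)) *
      (\prod_(j <= k < N) pl (nth (0, 0) Z k)).

Lemma has_integral_union_density N (A : set (plane R)) (a : 'I_n -> R) (b : R)
    (s : 'S_N) : measurable A ->
  (forall k, measurable_fun [set: plane R] (p k : plane R -> R)) ->
  (forall k x, 0 <= p k x) ->
  measurable_fun [set: plane R] (pl : plane R -> R) -> (forall x, 0 <= pl x) ->
  (forall k, \int[leb2]_(x in A) (p k x)%:E = (a k)%:E)%E ->
  (\int[leb2]_(x in A) (pl x)%:E = b%:E)%E ->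
  has_integral A (fun t => union_density (permt s t))
    (\sum_(j < n.+1) (\sum_(g : {ffun 'I_j -> 'I_n} | increasing g)
        Qweight q g * \prod_(k < j) a (g k)) *
      (if (j <= N)%N then nu (N - j) * b ^+ (N - j) else 0)).
Proof.
move=> mA mp p0 mpl pl0 pa plb; apply: has_integral_sum => // j _.
rewrite extend0_subn; case: leqP => [jN|_]; last first.
  rewrite mulr0 (_ : (fun t => _) = fun=> 0); first exact: has_integral0.
  by apply/funext => t; rewrite mul0r.
rewrite mulrCA; apply: has_integralZ => //.
rewrite mulr_suml; apply: has_integral_sum => // g _.
under eq_fun do rewrite -mulrA.
rewrite -mulrA; apply: has_integralZ => //.
by apply: (@has_integral_split _ N j A (fun k => p (g k)) pl (fun k => a (g k)) b s).
Qed.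

Lemma permt_permt N (s s' : 'S_N) (t : N.-tuple (R * R)) :
  permt s' (permt s t) = permt (s' * s)%g t.
Proof. by apply: eq_from_tnth => i; rewrite !tnth_mktuple permM. Qed.

End union_density.

(** * The kernel density is the global probability density of the union *)

Theorem theorem1 (R : realType) (d : measure_display)
    (Omega : measurableType d) (P : probability Omega R)
    (sigma m : R) (sigma_gt0 : 0 < sigma) (m_gt0 : 0 < m)
    (D : diagram R) (DW : [set` D] `<=` wedge)
    (* an enumeration of the features of the upper diagram *)
    (Nu : nat) (e : Nu.-tuple (R * R)) (eD : seq_mset e = upper_part sigma D)
    (X : 'I_Nu -> Omega -> diagram R)
    (X_singleton : forall j, singleton_diagram P
       (upper_weight sigma (tnth e j)) (upper_density sigma (tnth e j)) (X j))
    (X_indep : mutually_independent P 1 X)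
    (Du : Omega -> diagram R)
    (Du_union : forall w, Du w = \big[msetD/mset0]_(j < Nu) X j w)
    (nu : nat -> R)
    (nu_law : cardinality_law m (size (lower_part sigma D)) nu)
    (M : nat) (Dl : Omega -> diagram R)
    (Dl_iid : iid_diagram P M nu (lower_density sigma (lower_part sigma D)) Dl)
    (DuDl_indep : independent P Nu M Du Dl) :
  let q := fun j : 'I_Nu => upper_weight sigma (tnth e j) in
  let p := fun j : 'I_Nu => upper_density sigma (tnth e j) in
  let pl := lower_density sigma (lower_part sigma D) in
  global_pdf P (fun w => msetD (Du w) (Dl w))
    (fun (N : nat) (Z : N.-tuple (R * R)) =>
       \sum_(j < Nu.+1) extend0 nu (N%:Z - j%:Z) *
         \sum_(g : {ffun 'I_j -> 'I_Nu} | increasing g)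
           Qweight q g *
             (\prod_(k < j) p (g k) (nth (0, 0) Z k)) *
             (\prod_(j <= k < N) pl (nth (0, 0) Z k))).
Proof.
move=> q p pl.
have s0 : sigma != 0 by rewrite gt_eqF.
have [nu0 nu1 _ _] := nu_law.
have measurable_of_integrable (h : R * R -> R) :
    leb2_measure.-integrable [set: plane R] (EFin \o h) ->
    measurable_fun [set: plane R] (h : plane R -> R).
  by move=> /integrableP[/measurable_EFinP].
have ip k : leb2_measure.-integrable [set: plane R] (EFin \o p k).
  exact: integrable_upper_density.
have ipl : leb2_measure.-integrable [set: plane R] (EFin \o pl).
  exact: integrable_lower_density.
have mp k := measurable_of_integrable _ (ip k).
have mpl := measurable_of_integrable _ ipl.
have p0 k x : 0 <= p k x by exact: upper_density_ge0.
have pl0 x : 0 <= pl x by exact: lower_density_ge0.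
pose mass (h : R * R -> R) (A : set (plane R)) := fine (\int[leb2]_(x in A) (h x)%:E)%E.
have massE h A : measurable A -> leb2_measure.-integrable [set: plane R] (EFin \o h) ->
    (\int[leb2]_(x in A) (h x)%:E = (mass h A)%:E)%E.
  by move=> mA ih; rewrite fineK// integral_fin_num.
have mass0 (h : R * R -> R) A : (forall x, 0 <= h x) -> 0 <= mass h A.
  by move=> h0; apply: fine_ge0; apply: integral_ge0 => x _; rewrite lee_fin.
have q0 i : 0 <= q i by exact: upper_weight_ge0.
have q1 i : q i < 1 by exact: upper_weight_lt1.
(* The coefficient of degree N of the belief function at A. *)
pose value A N := \sum_(j < Nu.+1)
  (\sum_(g : {ffun 'I_j -> 'I_Nu} | increasing g)
     Qweight q g * \prod_(k < j) mass (p (g k)) A) *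
  (if (j <= N)%N then nu (N - j)%N * mass pl A ^+ (N - j) else 0).
have f_integral A N (s : 'S_N) : measurable A ->
    has_integral A (fun t => union_density q p nu pl (permt s t)) (value A N).
  move=> mA; apply: (@has_integral_union_density R Nu q p nu pl N A
      (fun k => mass (p k) A) (mass pl A) s) => //.
    by move=> k; exact: massE.
  exact: massE.
exists (fun N t => \sum_(s : 'S_N) union_density q p nu pl (permt s t)) => //.
have g_integral A N : measurable A ->
    has_integral A (fun t => \sum_(s : 'S_N) union_density q p nu pl (permt s t))
      (N`!%:R * value A N).
  move=> mA; have := has_integral_sum (index_enum _) mA
    (fun s (_ : xpredT s) => f_integral A N s mA).
  by rewrite sumr_const card_Sn mulr_natl.
split.
- by move=> N; have [] := g_integral _ N measurable_wedge.
- move=> N s t _.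
  rewrite [RHS](reindex_inj (mulIg s))/=.
  by apply: eq_bigr => s' _; rewrite permt_permt.
move=> A mA AW.
(* Both events are Borel in the spaces of diagrams, so independence applies. *)
transitivity (belief P Du A * belief P Dl A)%E.
  have Du1 w : diagrams_le Nu (Du w).
    by rewrite Du_union; apply: diagrams_le_big_msetD => j; have [[]] := X_singleton j.
  have [[DlM _] _] := Dl_iid.
  rewrite /belief -(preimage_inside A Du1) -(preimage_inside A DlM).
  rewrite -DuDl_indep; [|exact: borel_inside..].
  congr (P _); apply/seteqP; split=> w /=; first by move=> /subset_msetD[].
  by move=> [[_ DuA] [_ DlA]]; exact/subset_msetD.
rewrite (funext Du_union) (belief_union X_singleton)//; last first.
  by move=> j; rewrite (massE (p j)).
have mass_le1 : mass pl wedge <= 1.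
  by rewrite -lee_fin -massE//; [exact: integral_lower_density_le1|exact: measurable_wedge].
rewrite (belief_iid Dl_iid nu0 nu1 mpl pl0 (massE _ _ measurable_wedge ipl) mass_le1
  mA AW (massE _ _ mA ipl)).
have q_neq1 i : q i != 1 by rewrite lt_eqF.
have /(_ (fun j => mass (p j) A)) := prod_choice_increasing _ q_neq1.
rewrite {1}/q => ->.
rewrite -nneseries_convolution; last 2 first.
- move=> j; apply: sumr_ge0 => g _; rewrite mulr_ge0 ?prodr_ge0//.
  + by apply: Qweight_ge0 => i; rewrite q0 ltW.
  + by move=> k _; apply: mass0.
- by move=> k; rewrite mulr_ge0// exprn_ge0// mass0.
apply: eq_eseriesr => N _.
have [_ ->] := g_integral A N mA.
(* The sum over permutations has produced the factor N! that the expansion of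
   the belief function divides by. *)
by rewrite -EFinM mulrA mulVf ?mul1r// pnatr_eq0 -lt0n fact_gt0.
Qed.
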